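(* Let $\mathbf{B}$ be a pointed category with binary coproducts and kernels of split epimorphisms. The following conditions are equivalent: (a) the canonical adjunction $T\dashv S$, with $T:\mathbf{B}\times\mathbf{B}\to Pt(\mathbf{B})$, $T(X,B)=(X\sqcup B,[0\ 1],\iota_2,B)$, and $S:Pt(\mathbf{B})\to\mathbf{B}\times\mathbf{B}$, $S(A,\alpha,\beta,B)=(K[\alpha],B)$, is an equivalence of categories; (b) the category $\mathbf{B}$ satisfies the following two axioms: (A1) for all objects $X,B$, in the diagram $X\xrightarrow{\iota_1}X\sqcup B\xrightarrow{[0\ 1]}B$ (with $[0\ 1]$ split by $\iota_2$), the morphism $\iota_1$ is the kernel of $[0\ 1]$; (A2) the split short five lemma holds: given split epimorphisms $(A,\alpha,\beta,B)$ and $(A',\alpha',\beta',B')$ with kernels $k:X\to A$ of $\alpha$ and $k':X'\to A'$ of $\alpha'$, and morphisms $f:X\to X'$, $h:A\to A'$, $g:B\to B'$ with $hk=k'f$, $\alpha'h=g\alpha$, $h\beta=\beta'g$, if $g$ and $f$ are isomorphisms then $h$ is an isomorphism.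
   Context: A category is pointed if it is enriched in pointed sets: for every pair $X,Y$ of objects there is a specified morphism $0_{X,Y}:X\to Y$ with $0_{Z,W}f=0_{Y,W}$ and $f0_{X,Y}=0_{X,Z}$ for every $f:Y\to Z$. No zero object is assumed. A kernel of $\alpha$ is a morphism $k$ universal with $\alpha k=0$; $K[\alpha]$ is the (chosen) kernel object of $\alpha$. $Pt(\mathbf{B})$: objects $(A,\alpha,\beta,B)$ with $\alpha:A\to B$, $\beta:B\to A$, $\alpha\beta=1_B$ (split epimorphisms); morphisms are pairs $(f_1:A\to A',f_0:B\to B')$ with $\alpha'f_1=f_0\alpha$, $f_1\beta=\beta'f_0$. $\iota_1,\iota_2$ are coproduct injections and $[f\ g]$ is the morphism out of a coproduct with components $f,g$. *)

(* Defs.v *)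
From Stdlib Require Import ssreflect ssrfun ProofIrrelevance IndefiniteDescription.

Set Implicit Arguments.
Unset Strict Implicit.
Unset Printing Implicit Defensive.

Declare Scope cat_scope.
Delimit Scope cat_scope with cat.
Local Open Scope cat_scope.

Reserved Notation "g ∘ f" (at level 40, left associativity).

(** * Categories, functors, adjunctions *)

(* Equality of morphisms is Leibniz equality. *)
Record Category := {
  Obj :> Type;
  Hom : Obj -> Obj -> Type;
  id : forall X, Hom X X;
  comp : forall X Y Z, Hom Y Z -> Hom X Y -> Hom X Z;
  comp_id_l : forall X Y (f : Hom X Y), comp (id Y) f = f;
  comp_id_r : forall X Y (f : Hom X Y), comp f (id X) = f;
  comp_assoc : forall X Y Z W (h : Hom Z W) (g : Hom Y Z) (f : Hom X Y),
    comp h (comp g f) = comp (comp h g) f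
}.
Arguments Hom {_} _ _.
Arguments id {_} _.
Arguments comp {_ _ _ _} _ _.
Notation "g ∘ f" := (comp g f) : cat_scope.

Definition IsIso (C : Category) (X Y : C) (f : Hom X Y) : Prop :=
  exists g : Hom Y X, g ∘ f = id X /\ f ∘ g = id Y.

Record Functor (C D : Category) := {
  fobj :> C -> D;
  fmap : forall X Y : C, Hom X Y -> Hom (fobj X) (fobj Y);
  fmap_id : forall X : C, fmap (id X) = id (fobj X);
  fmap_comp : forall (X Y Z : C) (g : Hom Y Z) (f : Hom X Y),
    fmap (g ∘ f) = fmap g ∘ fmap f
}.
Arguments fmap {_ _} _ {_ _} _.

Definition idF (C : Category) : Functor C C.
Proof.
by refine {| fobj := fun X => X; fmap := fun X Y f => f |}.
Defined.

Definition compF (C D E : Category) (G : Functor D E) (F : Functor C D) :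
  Functor C E.
Proof.
refine {| fobj := fun X => G (F X);
          fmap := fun X Y f => fmap G (fmap F f) |}.
- by move=> X; rewrite !fmap_id.
- by move=> X Y Z g f; rewrite !fmap_comp.
Defined.

Record NatTrans (C D : Category) (F G : Functor C D) := {
  component :> forall X : C, Hom (F X) (G X);
  naturality : forall (X Y : C) (f : Hom X Y),
    component Y ∘ fmap F f = fmap G f ∘ component X
}.

Record Adjunction (C D : Category) (F : Functor C D) (G : Functor D C) := {
  adj_unit : NatTrans (idF C) (compF G F);
  adj_counit : NatTrans (compF F G) (idF D);
  triangle_l : forall X : C, adj_counit (F X) ∘ fmap F (adj_unit X) = id (F X);
  triangle_r : forall Y : D, fmap G (adj_counit Y) ∘ adj_unit (G Y) = id (G Y)
}.

(* An adjunction is an equivalence of categories when its unit and counit are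
   natural isomorphisms. *)
Definition IsEquivalence (C D : Category) (F : Functor C D) (G : Functor D C)
    (adj : Adjunction F G) : Prop :=
  (forall X : C, IsIso (adj_unit adj X)) /\
  (forall Y : D, IsIso (adj_counit adj Y)).

Definition Prod (C D : Category) : Category.
Proof.
refine {| Obj := C * D;
          Hom := fun P Q => (Hom P.1 Q.1 * Hom P.2 Q.2)%type;
          id := fun P => (id P.1, id P.2);
          comp := fun _ _ _ g f => (g.1 ∘ f.1, g.2 ∘ f.2) |}.
- by move=> P Q [f1 f2] /=; rewrite !comp_id_l.
- by move=> P Q [f1 f2] /=; rewrite !comp_id_r.
- by move=> P Q R S h g f /=; rewrite !comp_assoc.
Defined.

(** * The category of split epimorphisms *)

Record PtObj (B : Category) := {
  total : B;
  base : B;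
  proj : Hom total base;
  sect : Hom base total;
  proj_sect : proj ∘ sect = id base
}.

Record PtHom (B : Category) (P Q : PtObj B) := {
  top : Hom (total P) (total Q);
  bot : Hom (base P) (base Q);
  top_proj : proj Q ∘ top = bot ∘ proj P;
  top_sect : top ∘ sect P = sect Q ∘ bot
}.

Lemma PtHom_eq (B : Category) (P Q : PtObj B) (f g : PtHom P Q) :
  top f = top g -> bot f = bot g -> f = g.
Proof.
case: f g => [f1 f0 fp fs] [g1 g0 gp gs] /= e1 e0; subst.
by rewrite (proof_irrelevance _ fp gp) (proof_irrelevance _ fs gs).
Qed.

Definition PtId (B : Category) (P : PtObj B) : PtHom P P.
Proof.
refine {| top := id (total P); bot := id (base P) |};
  by rewrite comp_id_l comp_id_r.
Defined.

Definition PtComp (B : Category) (P Q R : PtObj B)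
  (g : PtHom Q R) (f : PtHom P Q) : PtHom P R.
Proof.
refine {| top := top g ∘ top f; bot := bot g ∘ bot f |}.
- by rewrite comp_assoc top_proj -comp_assoc top_proj comp_assoc.
- by rewrite -comp_assoc top_sect comp_assoc top_sect comp_assoc.
Defined.

Definition Pt (B : Category) : Category.
Proof.
refine {| Obj := PtObj B; Hom := @PtHom B; id := @PtId B; comp := @PtComp B |}.
- by move=> P Q f; apply: PtHom_eq; apply: comp_id_l.
- by move=> P Q f; apply: PtHom_eq; apply: comp_id_r.
- by move=> P Q R S h g f; apply: PtHom_eq; apply: comp_assoc.
Defined.

(** * Pointed categories, binary coproducts, kernels *)

Record PointedCategory := {
  pcat :> Category;
  zero : forall X Y : pcat, Hom X Y;
  zero_comp : forall (Y Z W : pcat) (f : Hom Y Z), zero Z W ∘ f = zero Y W;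
  comp_zero : forall (X Y Z : pcat) (f : Hom Y Z), f ∘ zero X Y = zero X Z
}.
Arguments zero {_} _ _.

Record BinaryCoproducts (C : Category) := {
  coprod : C -> C -> C;
  inj1 : forall X Y, Hom X (coprod X Y);
  inj2 : forall X Y, Hom Y (coprod X Y);
  copair : forall X Y Z, Hom X Z -> Hom Y Z -> Hom (coprod X Y) Z;
  copair_inj1 : forall X Y Z (f : Hom X Z) (g : Hom Y Z),
    copair f g ∘ inj1 X Y = f;
  copair_inj2 : forall X Y Z (f : Hom X Z) (g : Hom Y Z),
    copair f g ∘ inj2 X Y = g;
  copair_unique : forall X Y Z (h h' : Hom (coprod X Y) Z),
    h ∘ inj1 X Y = h' ∘ inj1 X Y -> h ∘ inj2 X Y = h' ∘ inj2 X Y -> h = h'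
}.
Arguments copair {_} _ {_ _ _} _ _.

Definition IsSplitEpi (C : Category) (A B : C) (a : Hom A B) : Prop :=
  exists b : Hom B A, a ∘ b = id B.

Definition IsKernel (C : PointedCategory) (K A B : C)
    (a : Hom A B) (k : Hom K A) : Prop :=
  a ∘ k = zero K B /\
  forall (M : C) (m : Hom M A), a ∘ m = zero M B ->
    exists! u : Hom M K, k ∘ u = m.

(* The kernel object [ker s] depends on [a] only: the existence proof [s] is
   irrelevant. *)
Record SplitEpiKernels (C : PointedCategory) := {
  ker : forall (A B : C) (a : Hom A B), IsSplitEpi a -> C;
  kermor : forall (A B : C) (a : Hom A B) (s : IsSplitEpi a), Hom (ker s) A;
  kermor_kernel : forall (A B : C) (a : Hom A B) (s : IsSplitEpi a),
    IsKernel a (kermor s)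
}.

Section Kernels.
Variables (C : PointedCategory) (K A B : C) (a : Hom A B) (k : Hom K A).
Hypothesis kP : IsKernel a k.

Lemma kernel_lift_ex (M : C) (m : Hom M A) :
  a ∘ m = zero M B -> exists u : Hom M K, k ∘ u = m.
Proof. by move=> /(proj2 kP) [u [e _]]; exists u. Qed.

Definition kernel_lift (M : C) (m : Hom M A) (e : a ∘ m = zero M B) :
  Hom M K := proj1_sig (constructive_indefinite_description _ (kernel_lift_ex e)).

Lemma kernel_liftE (M : C) (m : Hom M A) (e : a ∘ m = zero M B) :
  k ∘ kernel_lift e = m.
Proof.
exact (proj2_sig (constructive_indefinite_description _ (kernel_lift_ex e))).
Qed.

Lemma kernel_mono (M : C) (u v : Hom M K) : k ∘ u = k ∘ v -> u = v.
Proof.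
move=> e.
have z : a ∘ (k ∘ v) = zero M B by rewrite comp_assoc (proj1 kP) zero_comp.
have [w [_ wU]] := proj2 kP M _ z.
by rewrite -(wU _ e) (wU v).
Qed.
End Kernels.

(** * The canonical adjunction *)

Section CanonicalAdjunction.
Variables (B : PointedCategory) (cop : BinaryCoproducts B)
  (kers : SplitEpiKernels B).

Definition zero_one (X Y : B) : Hom (coprod cop X Y) Y :=
  copair cop (zero X Y) (id Y).

Definition T_obj (P : Prod B B) : Pt B :=
  {| proj := zero_one P.1 P.2; sect := inj2 cop P.1 P.2;
     proj_sect := copair_inj2 cop (zero P.1 P.2) (id P.2) |}.

Definition T_map (P Q : Prod B B) (f : Hom P Q) : Hom (T_obj P) (T_obj Q).
Proof.
refine (@Build_PtHom B (T_obj P) (T_obj Q)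
  (copair cop (inj1 cop Q.1 Q.2 ∘ f.1) (inj2 cop Q.1 Q.2 ∘ f.2)) f.2 _ _).
- apply: copair_unique; rewrite -!comp_assoc /= /zero_one.
  + by rewrite !copair_inj1 comp_assoc copair_inj1 comp_zero zero_comp.
  + by rewrite !copair_inj2 comp_assoc copair_inj2 comp_id_l comp_id_r.
- exact: copair_inj2.
Defined.

Definition T_functor : Functor (Prod B B) (Pt B).
Proof.
refine {| fobj := T_obj; fmap := T_map |}.
- move=> P; apply: PtHom_eq => //=; apply: copair_unique.
  + by rewrite copair_inj1 comp_id_l comp_id_r.
  + by rewrite copair_inj2 comp_id_l comp_id_r.
- move=> P Q R g f; apply: PtHom_eq => //=; apply: copair_unique.
  + by rewrite -!comp_assoc !copair_inj1 !comp_assoc copair_inj1.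
  + by rewrite -!comp_assoc !copair_inj2 !comp_assoc copair_inj2.
Defined.

Lemma PtObj_split (P : PtObj B) : IsSplitEpi (proj P).
Proof. by exists (sect P); apply: proj_sect. Qed.

Definition kernel_obj (P : PtObj B) : B := ker kers (PtObj_split P).
Definition kappa (P : PtObj B) : Hom (kernel_obj P) (total P) :=
  kermor kers (PtObj_split P).
Definition kappaP (P : PtObj B) : IsKernel (proj P) (kappa P) :=
  kermor_kernel kers (PtObj_split P).

Lemma K_map_zero (P Q : PtObj B) (f : PtHom P Q) :
  proj Q ∘ (top f ∘ kappa P) = zero (kernel_obj P) (base Q).
Proof.
by rewrite comp_assoc top_proj -comp_assoc (proj1 (kappaP P)) comp_zero.
Qed.

Definition K_map (P Q : PtObj B) (f : PtHom P Q) : Hom (kernel_obj P) (kernel_obj Q) :=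
  kernel_lift (kappaP Q) (K_map_zero f).

Lemma K_mapE (P Q : PtObj B) (f : PtHom P Q) :
  kappa Q ∘ K_map f = top f ∘ kappa P.
Proof. exact: kernel_liftE. Qed.

Definition S_functor : Functor (Pt B) (Prod B B).
Proof.
refine {| fobj := fun P : Pt B => (kernel_obj P, base P) : Prod B B;
          fmap := fun (P Q : Pt B) (f : Hom P Q) => (K_map f, bot f) |}.
- move=> P /=; congr pair; apply: (kernel_mono (kappaP P)).
  by rewrite K_mapE comp_id_l comp_id_r.
- move=> P Q R g f /=; congr pair; apply: (kernel_mono (kappaP R)).
  by rewrite K_mapE comp_assoc K_mapE -comp_assoc K_mapE comp_assoc.
Defined.

(* The unit at (X, B) is (u, 1_B), with u : X -> K[[0 1]] induced by inj1; the
   counit at (A, alpha, beta, B) is ([k beta], 1_B), with k the chosen kernel of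
   alpha. *)
Definition eta_component (P : Prod B B) : Hom P (S_functor (T_functor P)) :=
  (kernel_lift (kappaP (T_obj P))
     (copair_inj1 cop (zero P.1 P.2) (id P.2)), id P.2).

Lemma eta_componentE (P : Prod B B) :
  kappa (T_obj P) ∘ (eta_component P).1 = inj1 cop P.1 P.2.
Proof. exact: kernel_liftE. Qed.

Definition eta : NatTrans (idF (Prod B B)) (compF S_functor T_functor).
Proof.
refine {| component := eta_component : forall P : Prod B B,
            Hom (idF (Prod B B) P) (compF S_functor T_functor P) |}.
move=> P Q f; apply: injective_projections.
- apply: (kernel_mono (kappaP (T_obj Q))).
  have -> : (eta_component Q ∘ fmap (idF (Prod B B)) f).1
    = (eta_component Q).1 ∘ f.1 by [].
  have -> : (fmap (compF S_functor T_functor) f ∘ eta_component P).1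
    = K_map (T_map f) ∘ (eta_component P).1 by [].
  by rewrite !comp_assoc eta_componentE K_mapE -comp_assoc eta_componentE
    copair_inj1.
- by rewrite /= comp_id_l comp_id_r.
Defined.

Definition eps_component (P : Pt B) : Hom (T_functor (S_functor P)) P.
Proof.
refine (@Build_PtHom B (T_obj (S_functor P)) P
  (copair cop (kappa P) (sect P)) (id (base P)) _ _).
- rewrite /= comp_id_l; apply: copair_unique; rewrite -comp_assoc.
  + by rewrite !copair_inj1 (proj1 (kappaP P)).
  + by rewrite !copair_inj2 proj_sect.
- by rewrite /= copair_inj2 comp_id_r.
Defined.

Definition eps : NatTrans (compF T_functor S_functor) (idF (Pt B)).
Proof.
refine {| component := eps_component : forall P : Pt B,
            Hom (compF T_functor S_functor P) (idF (Pt B) P) |}.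
move=> P Q f; apply: PtHom_eq => /=; last by rewrite comp_id_l comp_id_r.
apply: copair_unique; rewrite -!comp_assoc.
- by rewrite !copair_inj1 comp_assoc copair_inj1 K_mapE.
- by rewrite !copair_inj2 comp_assoc copair_inj2 top_sect.
Defined.

Definition canonical_adjunction : Adjunction T_functor S_functor.
Proof.
refine {| adj_unit := eta; adj_counit := eps |}.
- move=> P; apply: PtHom_eq => /=; last by rewrite comp_id_l.
  apply: copair_unique; rewrite -!comp_assoc comp_id_l.
  + rewrite copair_inj1 comp_assoc copair_inj1; exact: eta_componentE.
  + by rewrite copair_inj2 comp_assoc copair_inj2 comp_id_r.
- move=> P; apply: injective_projections; last by rewrite /= comp_id_l.
  apply: (kernel_mono (kappaP P)).
  have -> : (fmap S_functor (eps P) ∘ eta (S_functor P)).1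
    = K_map (eps_component P) ∘ (eta_component (S_functor P)).1 by [].
  by rewrite comp_assoc K_mapE -comp_assoc eta_componentE copair_inj1 comp_id_r.
Defined.

Definition AxiomA1 : Prop :=
  forall X Y : B, IsKernel (zero_one X Y) (inj1 cop X Y).

End CanonicalAdjunction.

Definition AxiomA2 (B : PointedCategory) : Prop :=
  forall (P P' : PtObj B) (X X' : B)
    (k : Hom X (total P)) (k' : Hom X' (total P')),
    IsKernel (proj P) k -> IsKernel (proj P') k' ->
  forall (f : Hom X X') (h : Hom (total P) (total P'))
    (g : Hom (base P) (base P')),
    h ∘ k = k' ∘ f -> proj P' ∘ h = g ∘ proj P -> h ∘ sect P = sect P' ∘ g ->
    IsIso g -> IsIso f -> IsIso h.

(* Main.v *)
(** The counit at a point (A, α, β, B) is [k β], and the unit at (X, B) is the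
comparison of ι1 with the chosen kernel of [0 1].  So the unit is invertible iff
(A1) holds.  If every [k β] is invertible, a morphism of points satisfies
h [k β] = [k' β'] (f ⊔ g), hence h is invertible when f and g are.  Conversely,
by (A1) the counit is a morphism of split short exact sequences with identities
at both ends, so (A2) makes it invertible. *)
From Stdlib Require Import ssreflect ssrfun.
Require Import Defs.

Set Implicit Arguments.
Unset Strict Implicit.
Unset Printing Implicit Defensive.

Local Open Scope cat_scope.

Lemma IsIso_id (C : Category) (X : C) : IsIso (id X).
Proof. by exists (id X); rewrite comp_id_l. Qed.

Lemma IsIso_comp (C : Category) (X Y Z : C) (g : Hom Y Z) (f : Hom X Y) :
  IsIso g -> IsIso f -> IsIso (g ∘ f).
Proof.
move=> [g' [g'g gg']] [f' [f'f ff']]; exists (f' ∘ g'); split.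
- by rewrite comp_assoc -(comp_assoc f') g'g comp_id_r.
- by rewrite comp_assoc -(comp_assoc g) ff' comp_id_r.
Qed.

Lemma IsIso_cancel_r (C : Category) (X Y Z : C) (g : Hom Y Z) (f : Hom X Y) :
  IsIso f -> IsIso (g ∘ f) -> IsIso g.
Proof.
move=> [f' [f'f ff']] gf_iso.
rewrite -(comp_id_r g) -ff' comp_assoc.
by apply: IsIso_comp => //; exists f.
Qed.

Lemma Prod_iso_fst (C D : Category) (P Q : Prod C D) (f : Hom P Q) :
  IsIso f -> IsIso f.1.
Proof. by move=> [g [gf fg]]; exists g.1; split; [case: gf | case: fg]. Qed.

Lemma Prod_iso (C D : Category) (P Q : Prod C D) (f : Hom P Q) :
  IsIso f.1 -> IsIso f.2 -> IsIso f.
Proof.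
move=> [g1 [gf1 fg1]] [g2 [gf2 fg2]]; exists (g1, g2).
by split; apply: injective_projections.
Qed.

Lemma Pt_iso_top (B : Category) (P Q : Pt B) (f : Hom P Q) :
  IsIso f -> IsIso (top f).
Proof.
move=> [g [gf fg]]; exists (top g).
by split; [apply: (f_equal (@top _ _ _) gf) | apply: (f_equal (@top _ _ _) fg)].
Qed.

(** The componentwise inverses commute with projections and sections automatically, so they assemble
    into a morphism of points. *)
Lemma Pt_iso (B : Category) (P Q : Pt B) (f : Hom P Q) :
  IsIso (top f) -> IsIso (bot f) -> IsIso f.
Proof.
move=> [g1 [gf1 fg1]] [g0 [gf0 fg0]].
have gp : proj P ∘ g1 = g0 ∘ proj Q.
  (* Insert [g0 ∘ bot f] on the left; [top_proj] then trades [bot f] for [top f], which cancels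
     against [g1]. The proof of [gs] is dual, inserting [bot f ∘ g0] on the right. *)
  rewrite -(comp_id_l (proj P ∘ g1)) -gf0 -(comp_assoc g0) (comp_assoc (bot f)).
  by rewrite -top_proj -(comp_assoc (proj Q)) fg1 comp_id_r.
have gs : g1 ∘ sect Q = sect P ∘ g0.
  rewrite -(comp_id_r (g1 ∘ sect Q)) -fg0 comp_assoc -(comp_assoc g1).
  by rewrite -top_sect (comp_assoc g1) gf1 comp_id_l.
by exists (Build_PtHom gp gs); split; apply: PtHom_eq.
Qed.

(** The inverse is the lift of [k'] through [k]; both composites are identities because kernels are
    monic. *)
Lemma kernel_comparison_iso (C : PointedCategory) (K K' A B : C)
    (a : Hom A B) (k : Hom K A) (k' : Hom K' A) (u : Hom K K') :
  IsKernel a k -> IsKernel a k' -> k' ∘ u = k -> IsIso u.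
Proof.
move=> kP k'P k'u; have [v kv] := kernel_lift_ex kP (proj1 k'P).
exists v; split.
- by apply: (kernel_mono kP); rewrite comp_assoc kv k'u comp_id_r.
- by apply: (kernel_mono k'P); rewrite comp_assoc k'u kv comp_id_r.
Qed.

Lemma IsKernel_comp_iso (C : PointedCategory) (K K' A B : C)
    (a : Hom A B) (k : Hom K A) (u : Hom K' K) :
  IsKernel a k -> IsIso u -> IsKernel a (k ∘ u).
Proof.
move=> kP [v [vu uv]]; split; first by rewrite comp_assoc (proj1 kP) zero_comp.
move=> M m am; have [w kw] := kernel_lift_ex kP am.
exists (v ∘ w); split; first by rewrite -comp_assoc (comp_assoc u) uv comp_id_l.
move=> x kux; rewrite -(comp_id_l x) -vu -comp_assoc; congr (v ∘ _).
by apply: (kernel_mono kP); rewrite kw comp_assoc.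
Qed.

Section BinaryCoproducts.
Variables (C : Category) (cop : BinaryCoproducts C).

Lemma comp_copair (X Y Z W : C) (h : Hom Z W) (f : Hom X Z) (g : Hom Y Z) :
  h ∘ copair cop f g = copair cop (h ∘ f) (h ∘ g).
Proof.
by apply: copair_unique; rewrite -comp_assoc ?copair_inj1 ?copair_inj2.
Qed.

(** This is f ⊔ g, the top component of [T_map] at the pair [(f, g)]. *)
Definition cosum (X X' Y Y' : C) (f : Hom X X') (g : Hom Y Y') :
    Hom (coprod cop X Y) (coprod cop X' Y') :=
  copair cop (inj1 cop X' Y' ∘ f) (inj2 cop X' Y' ∘ g).

Lemma copair_cosum (X X' Y Y' Z : C) (f : Hom X X') (g : Hom Y Y')
    (p : Hom X' Z) (q : Hom Y' Z) :
  copair cop p q ∘ cosum f g = copair cop (p ∘ f) (q ∘ g).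
Proof. by rewrite comp_copair !comp_assoc copair_inj1 copair_inj2. Qed.

Lemma copair_inj (X Y : C) :
  copair cop (inj1 cop X Y) (inj2 cop X Y) = id (coprod cop X Y).
Proof.
by apply: copair_unique; rewrite comp_id_l ?copair_inj1 ?copair_inj2.
Qed.

Lemma cosum_iso (X X' Y Y' : C) (f : Hom X X') (g : Hom Y Y') :
  IsIso f -> IsIso g -> IsIso (cosum f g).
Proof.
move=> [f' [f'f ff']] [g' [g'g gg']]; exists (cosum f' g').
by split; rewrite copair_cosum -!comp_assoc ?f'f ?ff' ?g'g ?gg' !comp_id_r
  copair_inj.
Qed.

End BinaryCoproducts.

Section CanonicalAdjunction.
Variables (B : PointedCategory) (cop : BinaryCoproducts B)
  (kers : SplitEpiKernels B).

Lemma unit_iso_iff_A1 :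
  (forall P, IsIso (adj_unit (canonical_adjunction cop kers) P)) <->
  AxiomA1 cop.
Proof.
split.
- move=> unit_iso X Y.
  (* Replace ι1 by the chosen kernel of [0 1] precomposed with the first component of the unit. *)
  have /= <- := eta_componentE cop kers ((X, Y) : Prod B B).
  apply: IsKernel_comp_iso.
  + exact: (kappaP kers (T_obj cop ((X, Y) : Prod B B))).
  + exact: Prod_iso_fst (unit_iso (X, Y)).
- move=> A1 P; apply: Prod_iso; last exact: IsIso_id.
  exact: kernel_comparison_iso (A1 P.1 P.2) (kappaP kers (T_obj cop P))
    (eta_componentE cop kers P).
Qed.

(** The counit is built from the chosen kernel, whereas (A2) allows any kernel. The two differ by an
    isomorphism u, and [k β] is the counit's top component after u ⊔ 1. *)
Lemma copair_kernel_sect_iso (P : PtObj B) (X : B) (k : Hom X (total P)) :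
  IsIso (eps_component cop kers P) -> IsKernel (proj P) k ->
  IsIso (copair cop k (sect P)).
Proof.
move=> /Pt_iso_top /= eps_iso kP.
have [u ku] := kernel_lift_ex (kappaP kers P) (proj1 kP).
have -> : copair cop k (sect P) =
    copair cop (kappa kers P) (sect P) ∘ cosum cop u (id (base P)).
  by rewrite copair_cosum ku comp_id_r.
apply: IsIso_comp eps_iso _; apply: cosum_iso (IsIso_id _).
exact: kernel_comparison_iso kP (kappaP kers P) ku.
Qed.

Lemma counit_iso_A2 :
  (forall P, IsIso (adj_counit (canonical_adjunction cop kers) P)) ->
  AxiomA2 B.
Proof.
move=> eps_iso P P' X X' k k' kP k'P f h g hk _ hs g_iso f_iso.
apply: (IsIso_cancel_r (copair_kernel_sect_iso (eps_iso P) kP)).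
(* h [k β] = [hk hβ] = [k'f β'g] = [k' β'] (f ⊔ g). *)
rewrite comp_copair hk hs -copair_cosum; apply: IsIso_comp.
- exact: copair_kernel_sect_iso (eps_iso P') k'P.
- exact: cosum_iso.
Qed.

Lemma A1_A2_counit_iso : AxiomA1 cop -> AxiomA2 B ->
  forall P, IsIso (adj_counit (canonical_adjunction cop kers) P).
Proof.
move=> A1 A2 P.
apply: Pt_iso; last exact: IsIso_id.
(* The upper row is the point T(S(P)), with ι1 as its kernel by (A1); the lower row is [P] with its
   chosen kernel. *)
apply: (A2 (T_obj cop (S_functor kers P)) P _ _ _ _ (A1 _ _) (kappaP kers P)
  (id _) _ (id _)) (IsIso_id _) (IsIso_id _) => /=.
- by rewrite copair_inj1 comp_id_r.
- exact: top_proj (eps_component cop kers P).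
- exact: top_sect (eps_component cop kers P).
Qed.

End CanonicalAdjunction.

Theorem theorem9 (B : PointedCategory) (cop : BinaryCoproducts B)
    (kers : SplitEpiKernels B) :
  IsEquivalence (canonical_adjunction cop kers) <->
  AxiomA1 cop /\ AxiomA2 B.
Proof.
split.
- by move=> [/unit_iso_iff_A1 A1 /counit_iso_A2 A2].
- move=> [A1 A2]; split; first exact/unit_iso_iff_A1.
  exact: A1_A2_counit_iso.
Qed.
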